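(* Let $X$ be a finite simplicial complex, let $n \geq 1$ and $k\in\{1,\dots,n\}$, and let $\alpha$ be a cocycle with support $A=\{a_1,\dots,a_m\}\subseteq X_n$ (the $a_i$ distinct), i.e. $\alpha(x)=1$ if $x\in A$ and $\alpha(x)=0$ for any simplex $x\notin A$. Let $\beta=(\alpha\otimes\alpha)\Delta_{n-k}(-)$, and let $B\subseteq X_{n+k}$ be the output of the Steenrod square algorithm (described in the context) on input $A$ and $k$. Then $\operatorname{supp}\beta=B$; that is, for $x\in X_{n+k}$ one has $\beta(x)=1$ if $x\in B$ and $\beta(x)=0$ if $x\notin B$.
   Context: A simplicial complex is a pair consisting of a poset $V$ of vertices and a set $X$ of (finite) subsets of $V$, called simplices, such that the order of $V$ restricts to a total order on each element of $X$, every singleton $\{v\}$ with $v\in V$ is in $X$, and any subset of an element of $X$ is in $X$; it is denoted simply $X$. The set of $n$-simplices (those with $n+1$ vertices) is $X_n$, written $[v_0,\dots,v_n]$ with vertices in increasing order; $d_j([v_0,\dots,v_n])=[v_0,\dots,\widehat v_j,\dots,v_n]$. For $U=\{u_1<\dots<u_r\}\subseteq\{0,\dots,n\}$ and $x\in X_n$, $d_U(x)=d_{u_1}\cdots d_{u_r}(x)$, with $d_\emptyset(x)=x$. $C_n(X;\mathbb{F}_2)$ is the $\mathbb{F}_2$-vector space freely generated by $X_n$ for $n\geq 0$ (and $0$ for $n<0$), with boundary $\partial x=\sum_{j=0}^n d_j(x)$; cochains are linear maps $C_\bullet(X;\mathbb{F}_2)\to\mathbb{F}_2$, and a cocycle is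 a cochain $\alpha$ with $\alpha\circ\partial=0$. Cup-$i$ coproducts: for an integer $i$, $\Delta_i\colon C_\bullet(X;\mathbb{F}_2)\to C_\bullet(X;\mathbb{F}_2)\otimes C_\bullet(X;\mathbb{F}_2)$ is the linear map which on $x\in X_p$ is $0$ if $i\notin\{0,\dots,p\}$ and otherwise $\Delta_i(x)=\sum d_{U^0}(x)\otimes d_{U^1}(x)$, the sum being over all $U=\{u_1<\dots<u_{p-i}\}\subseteq\{0,\dots,p\}$, with $U^0=\{u_j\in U\mid u_j\equiv j \bmod 2\}$ and $U^1=\{u_j\in U\mid u_j\not\equiv j\bmod 2\}$. For cochains $\alpha,\alpha'$, the cochain $(\alpha\otimes\alpha')\Delta_i(-)$ sends $x$ to the value of $\alpha\otimes\alpha'$ on $\Delta_i(x)$. (The cochain $\beta$ is a representative of the Steenrod square $Sq^k([\alpha])$.) Notation: $S\,\triangle\,S'=(S\cup S')\setminus(S\cap S')$ for sets $S,S'$. For a finite totally ordered set $S$, $\mathrm{pos}_S\colon S\to\mathbb{N}$ sends $s$ to the cardinality of $\{s'\in S\mid s'\le s\}$. Steenrod square algorithm. Input: $A=\{a_1,\dots,a_m\}\subseteq X_n$ and $k\in\{1,\dots,n\}$. Initialize $B=\emptyset$. For each pair $i<j$ in $\{1,\dots,m\}$, let $a_{ij}=a_i\cup a_j$ (union of vertex sets). If $a_{ij}\in X_{n+k}$, do the following: set $\overline a_i=a_i\setminus a_j$, $\overline a_j=a_j\setminus a_i$, $\overline a_{ij}=\overline a_i\cup\overline a_j$; for $v\in\overline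 a_{ij}$ set $\mathrm{ind}(v)=\mathrm{pos}_{a_{ij}}(v)+\mathrm{pos}_{\overline a_{ij}}(v)\bmod 2$, and for a subset $S\subseteq\overline a_{ij}$ set $\mathrm{ind}(S)=\{\mathrm{ind}(v)\mid v\in S\}$; if $\mathrm{ind}(\overline a_i)\,\triangle\,\mathrm{ind}(\overline a_j)=\{0,1\}$, replace $B$ by $B\,\triangle\,\{a_{ij}\}$. Output: the final $B$. *)

(* Defs.v *)
From HB Require Import structures.
From mathcomp Require Import all_boot all_order all_algebra.

Set Implicit Arguments.
Unset Strict Implicit.
Unset Printing Implicit Defensive.

Import Order.TTheory GRing.Theory.
Local Open Scope ring_scope.

Definition symdiff (T : finType) (A B : {set T}) : {set T} :=
  (A :|: B) :\: (A :&: B).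

Definition pos (d : Order.disp_t) (V : finPOrderType d) (S : {set V}) (s : V)
  : nat := #|[set s' in S | (s' <= s)%O]|.

Local Notation F2 := ('F_2)^o.

Definition freemod (S : finType) := {ffun S -> F2}.
HB.instance Definition _ (S : finType) := GRing.Lmodule.on (freemod S).

Definition basis (S : finType) (s : S) : freemod S :=
  [ffun t => (t == s)%:R].

Definition linext (S : finType) (W : lmodType 'F_2) (f : S -> W)
  (c : freemod S) : W := \sum_(s : S) (c s : 'F_2) *: f s.

Fact linext_is_linear (S : finType) (W : lmodType 'F_2) (f : S -> W) :
  linear (linext f).
Proof.
move=> r c c'; rewrite /linext scaler_sumr -big_split /=.
by apply: eq_bigr => s _; rewrite !ffunE scalerDl scalerA.
Qed.
HB.instance Definition _ (S : finType) (W : lmodType 'F_2) (f : S -> W) :=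
  GRing.isLinear.Build 'F_2 (freemod S) W _ (linext f) (linext_is_linear f).

Lemma linext_basis (S : finType) (W : lmodType 'F_2) (f : S -> W) (s : S) :
  linext f (basis s) = f s.
Proof.
rewrite /linext (bigD1 s) //= ffunE eqxx scale1r big1 ?addr0 // => t ts.
by rewrite ffunE (negPf ts) scale0r.
Qed.

(* The tensor product of the free modules on S and T is the free module on
   S * T, a basis of it being given by the elementary tensors of basis
   elements. *)
Definition tens (S T : finType) (c : freemod S) (c' : freemod T)
  : freemod (S * T)%type := [ffun p => c p.1 * c' p.2].

Definition tens_form (S T : finType) (f : {linear freemod S -> F2})
  (g : {linear freemod T -> F2})
  : {linear freemod (S * T)%type -> F2} :=
  linext (fun p : S * T => f (basis p.1) * g (basis p.2) : F2).

Lemma freemod_sum (S : finType) (c : freemod S) :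
  c = \sum_(s : S) (c s : 'F_2) *: basis s.
Proof.
apply/ffunP => t; rewrite sum_ffunE (bigD1 t) //= !ffunE eqxx.
rewrite big1 ?addr0; first by rewrite /GRing.scale /= mulr1.
by move=> s st; rewrite !ffunE eq_sym (negPf st) /GRing.scale /= mulr0.
Qed.

Lemma tens_formE (S T : finType) (f : {linear freemod S -> F2})
  (g : {linear freemod T -> F2}) (c : freemod S) (c' : freemod T) :
  tens_form f g (tens c c') = f c * g c'.
Proof.
rewrite {2}(freemod_sum c) {2}(freemod_sum c') !linear_sum /= big_distrlr /=.
rewrite pair_big /= /linext; apply: eq_bigr => -[s t] _ /=.
rewrite ffunE [f (_ *: _)]linearZ [g (_ *: _)]linearZ /=.
exact: (mulrACA (c s : 'F_2) (c' t : 'F_2) (f (basis s)) (g (basis t))).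
Qed.

(* A complex has finitely many simplices iff it has finitely many vertices,
   since all singletons are simplices; hence the finite type of vertices.
   As in any downward closed family, the empty set is allowed here; it is
   excluded from the type [simplex] of generators of the chains below. *)
Record complex (d : Order.disp_t) (V : finPOrderType d) := Complex {
  simplices :> {set {set V}};
  complex_total : forall x, x \in simplices ->
    {in x &, forall u v, (u <= v) || (v <= u)}%O;
  complex_set1 : forall v : V, [set v] \in simplices;
  complex_sub : forall x y : {set V},
    x \in simplices -> y \subset x -> y \in simplices
}.

Section Chains.

Context {d : Order.disp_t} {V : finPOrderType d} (X : complex V).
Implicit Types (x y : {set V}) (n : nat).

Definition nsimplices n : {set {set V}} := [set x in simplices X | #|x| == n.+1].

Definition dim x : nat := #|x|.-1.

(* When x is totally ordered, this is its increasing list of vertices. *)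
Definition vertices x : seq V := sort <=%O (enum x).

Definition face x (j : nat) : {set V} :=
  [set v in x | index v (vertices x) != j].

(* [enum U] is increasing and [foldr] applies the face operator with the
   largest index first. *)
Definition faces p (U : {set 'I_p}) x : {set V} :=
  foldr (fun (u : 'I_p) y => face y u) x (enum U).

(* For U = {u_1 < u_2 < ...}, the rank of u_j is j, starting from 1. *)
Definition rank p (U : {set 'I_p}) (u : 'I_p) : nat := (index u (enum U)).+1.
Definition part0 p (U : {set 'I_p}) : {set 'I_p} :=
  [set u in U | u == rank U u %[mod 2]].
Definition part1 p (U : {set 'I_p}) : {set 'I_p} :=
  [set u in U | u != rank U u %[mod 2]].

Definition simplex : finType := {x : {set V} | (x \in X) && (x != set0)}.

(* The direct sum of the C_n(X; F_2) over all n >= 0. *)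
Definition chain : lmodType 'F_2 := freemod simplex.

(* In particular [gen set0 = 0], in accordance with C_{-1} = 0. *)
Definition gen x : chain :=
  if insub x is Some s then basis (s : simplex) else 0.

Definition boundary : {linear chain -> chain} :=
  linext (fun s : simplex => \sum_(j < (dim (val s)).+1) gen (face (val s) j)).

Definition cochain := {linear chain -> F2}.

Definition cocycle (alpha : cochain) : Prop :=
  forall c : chain, alpha (boundary c) = 0.

Definition supp (alpha : cochain) : {set {set V}} :=
  [set x in simplices X | alpha (gen x) != 0].

Definition coproduct_basis (i : int) (s : simplex)
    : freemod (simplex * simplex)%type :=
  let x := val s in let p := dim x in
  if (0 <= i <= p%:Z)%R then
    \sum_(U : {set 'I_p.+1} | #|U|%:Z == p%:Z - i)
      tens (gen (faces (part0 U) x)) (gen (faces (part1 U) x))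
  else 0.

Definition coproduct (i : int)
  : {linear chain -> freemod (simplex * simplex)%type} :=
  linext (coproduct_basis i).

Definition cup (i : int) (alpha alpha' : cochain) : cochain :=
  tens_form alpha alpha' \o coproduct i.

Definition steenrod_step (n k : nat) (B : {set {set V}}) (ai aj : {set V})
    : {set {set V}} :=
  let aij := ai :|: aj in
  if aij \in nsimplices (n + k) then
    let bi := ai :\: aj in
    let bj := aj :\: ai in
    let bij := bi :|: bj in
    let ind (v : V) : 'F_2 := (pos aij v + pos bij v)%:R in
    if symdiff (ind @: bi) (ind @: bj) == [set 0; 1]
    then symdiff B [set aij] else B
  else B.

(* The pairs i < j are visited lexicographically; since symmetric difference
   is associative and commutative, the order does not affect the output. *)
Definition steenrod_alg (n k m : nat) (a : 'I_m -> {set V}) : {set {set V}} :=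
  foldl (fun B p => steenrod_step n k B (a p.1) (a p.2)) set0
    [seq p : 'I_m * 'I_m <- [seq (i, j) | i <- enum 'I_m, j <- enum 'I_m]
    | (p.1 < p.2)%N].

End Chains.

(* Main.v *)
Require Import Defs.
From mathcomp Require Import all_boot all_order all_algebra zify.
Import Order.TTheory GRing.Theory.
Local Open Scope ring_scope.

Set Implicit Arguments.
Unset Strict Implicit.
Unset Printing Implicit Defensive.

(** Fix a simplex x with p + 1 vertices, and identify its vertices with the
    ordinals below p + 1 by an order isomorphism f ([vertex_enumeration]); the
    face d_U x is then x minus f(U), and ranks in U become positions in f(U).
    Evaluating (alpha (x) alpha) Delta_(n-k) on x counts, modulo 2, the sets U
    with d_(U^0) x and d_(U^1) x both in A, so it is the sum over ordered
    pairs (i, j) of the number of sets U such that d_(U^0) x = a_i and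
    d_(U^1) x = a_j.

    The main point is that such a U is determined by the pair
    ([face_pair_split]): U^0 and U^1 are disjoint, so a_i and a_j cover x,
    f(U^0) is x minus a_i, that is a_j minus a_i, and f(U^1) is a_i minus a_j.
    Hence f(U) is the symmetric difference of a_i and a_j. For v = f(u), pos
    of v in x is u + 1 and pos of v in f(U) is the rank of u, so that ind(v)
    is 1 on f(U^0) and 0 on f(U^1). Conversely a pair covering x with these
    values of ind yields a suitable U. So each ordered pair contributes 0 or 1
    ([sum_is_split]).

    It remains to gather (i, j) with (j, i). No pair (i, i) contributes,
    because a_i is smaller than x. For i < j the contributions of (i, j) and
    (j, i) exclude each other, and one of them is 1 exactly when a_i and a_j
    cover x and ind is constant on each of the two differences, with opposite
    values. For nonempty differences that is the test of the algorithm
    ([is_split_sym]), whose output is a sum modulo 2 over the pairs i < j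
    ([in_steenrod_alg]). Outside dimension n + k both sides vanish, by counting
    vertices ([supp_cup_nsimplices]). *)

(** * Arithmetic modulo 2 *)

Lemma F2P (c : 'F_2) : {c = 0} + {c = 1}.
Proof. by case: c => [[|[|r]] lt_r] //; [left | right]; apply/val_inj. Qed.

Lemma F2_bool (c : 'F_2) : c = (c != 0)%:R.
Proof. by case: (F2P c) => ->. Qed.

Lemma F2_neq1 (c : 'F_2) : (c == 0) = (c != 1).
Proof. by case: (F2P c) => ->. Qed.

Lemma F2_addb (b c : bool) : (b (+) c)%:R = b%:R + c%:R :> 'F_2.
Proof. by case: b; case: c => //; apply/val_inj. Qed.

Lemma F2_natr_odd (r : nat) : r%:R = (odd r)%:R :> 'F_2.
Proof.
rewrite -{1}[r]odd_double_half natrD -muln2 natrM.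
by rewrite [2%:R](_ : _ = 0) ?mulr0 ?addr0 //; apply/val_inj.
Qed.

Lemma F2_natr_eq0 (b : bool) : (b%:R == 0 :> 'F_2) = ~~ b.
Proof. by case: b. Qed.

Lemma F2_natr_eq1 (b : bool) : (b%:R == 1 :> 'F_2) = b.
Proof. by case: b. Qed.

Lemma imset_eq_set1 (T T' : finType) (h : T -> T') (S : {set T}) c :
  S != set0 -> [forall v in S, h v == c] -> h @: S = [set c].
Proof.
move=> /set0Pn[s sS] /forall_inP hc; apply/setP=> c'; rewrite inE.
apply/imsetP/eqP => [[v /hc/eqP-> ->//]|->].
by exists s; rewrite ?(eqP (hc _ sS)).
Qed.

(** Two nonempty subsets of a two-element set have full symmetric difference
    only if they are complementary, hence distinct singletons. *)
Lemma symdiff_imset_full (T : finType) (h : T -> 'F_2) (S S' : {set T}) :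
  S != set0 -> S' != set0 ->
  (symdiff (h @: S) (h @: S') == [set 0; 1]) =
    ([forall v in S', h v == 1] && [forall v in S, h v == 0]) ||
    ([forall v in S, h v == 1] && [forall v in S', h v == 0]).
Proof.
move=> S0 S'0; apply/eqP/orP => [full|[] /andP[h1 h0]]; last 2 first.
- rewrite (imset_eq_set1 S0 h0) (imset_eq_set1 S'0 h1).
  by apply/setP=> c; rewrite !inE; case: (F2P c) => ->.
- rewrite (imset_eq_set1 S0 h1) (imset_eq_set1 S'0 h0).
  by apply/setP=> c; rewrite !inE; case: (F2P c) => ->.
have [[s sS] [s' sS']] := (set0Pn _ S0, set0Pn _ S'0).
have opp v v' : v \in S -> v' \in S' -> h v != h v'.
  move=> vS vS'; apply/eqP => hvv.
  have := in_set2 (h v) 0 1; rewrite -full !inE imset_f //= hvv imset_f //=.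
  by case: (F2P (h v')) => ->.
case: (F2P (h s)) (opp s s' sS sS') => hs; case: (F2P (h s')) => hs';
  rewrite hs hs' // => _; [left | right]; apply/andP; split;
  apply/forall_inP => v vS.
- by case: (F2P (h v)) (opp s v sS vS); rewrite hs => ->.
- by case: (F2P (h v)) (opp v s' vS sS'); rewrite hs' => ->.
- by case: (F2P (h v)) (opp v s' vS sS'); rewrite hs' => ->.
- by case: (F2P (h v)) (opp s v sS vS); rewrite hs => ->.
Qed.

(** * Faces of a totally ordered set *)

Section Vertices.

Variables (d : Order.disp_t) (V : finPOrderType d).
Implicit Types (x y S : {set V}).

Lemma mem_vertices x v : (v \in vertices x) = (v \in x).
Proof. by rewrite mem_sort mem_enum. Qed.

Lemma vertices_uniq x : uniq (vertices x).
Proof. by rewrite sort_uniq enum_uniq. Qed.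

Lemma size_vertices x : size (vertices x) = #|x|.
Proof. by rewrite size_sort cardE. Qed.

Definition chain_set x := {in x &, total (<=%O : rel V)}.

Lemma vertices_sorted x : chain_set x -> sorted <=%O (vertices x).
Proof.
move=> x_tot; apply: (sort_sorted_in (P := mem x)) => //.
by apply/allP => v; rewrite mem_enum.
Qed.

Lemma vertices_filter x y : chain_set x -> y \subset x ->
  vertices y = [seq v <- vertices x | v \in y].
Proof.
move=> x_tot yx; apply: (sorted_eq le_trans le_anti).
- by apply: vertices_sorted => u v /(subsetP yx) ux /(subsetP yx) /(x_tot _ _ ux).
- exact: sorted_filter le_trans _ _ (vertices_sorted x_tot).
apply: uniq_perm; rewrite ?filter_uniq ?vertices_uniq // => v.
by rewrite mem_filter !mem_vertices andb_idr //; apply: (subsetP yx).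
Qed.

(** Deleting entries behind position u of a list changes neither the entry at
    position u nor whether an entry stands at that position; this is why
    faces may be taken one by one, largest index first. *)
Lemma index_filter_prefix (T : eqType) (P : pred T) (t : seq T) (u : nat) v :
    all P (take u.+1 t) -> v \in t -> P v ->
  (index v (filter P t) == u) = (index v t == u).
Proof.
move=> allP vt Pv; rewrite -{1 2}(cat_take_drop u.+1 t) filter_cat.
rewrite (all_filterP allP) !index_cat; case: ifPn => // vNtake.
rewrite size_take; case: ltnP => [u_lt|/take_oversize ttake].
  (* v lies behind the prefix, so both indices are at least u + 1 *)
  by rewrite !gtn_eqF // addSn ltnS leq_addr.
by rewrite ttake vt in vNtake.
Qed.

Lemma foldr_face x (s : seq nat) : chain_set x -> sorted ltn s ->
  foldr (fun u y => face y u) x s =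
  [set v in x | index v (vertices x) \notin s].
Proof.
move=> x_tot; elim: s => [|u s IHs] /= us.
  by apply/setP => v; rewrite !inE andbT.
rewrite IHs ?(path_sorted us) //; set y := [set v in x | _].
have u_min : all (ltn u) s by rewrite (order_path_min ltn_trans us).
apply/setP => v; rewrite !inE negb_or; case: (boolP (v \in x)) => //= vx.
case: (boolP (_ \in s)) => vs; rewrite ?andbF ?andbT //=.
congr (~~ _); rewrite (@vertices_filter x) //; last first.
  by apply/subsetP => w; rewrite inE => /andP[].
apply: index_filter_prefix; rewrite ?mem_vertices ?inE ?vx //.
apply/allP => w w_take; have wt := mem_take w_take.
rewrite inE -mem_vertices wt /=; apply/negP => /(allP u_min) /=.
by rewrite ltnNge -ltnS index_ltn.
Qed.

End Vertices.

(** * Positions and ranks *)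

Lemma pos_index (d : Order.disp_t) (T : finPOrderType d) (S : {set T})
    (t : seq T) (v : T) :
    sorted <=%O t -> uniq t -> t =i S -> v \in S ->
  pos S v = (index v t).+1.
Proof.
move=> t_sorted t_uniq tS vS.
have -> : pos S v = count (fun w => w <= v)%O t.
  rewrite /pos cardE -size_filter; apply: perm_size; apply: uniq_perm.
  - exact: enum_uniq.
  - exact: filter_uniq.
  by move=> w; rewrite mem_enum inE mem_filter tS andbC.
move: t_sorted t_uniq; rewrite -tS in vS; case/splitPr: vS => t1 t2.
rewrite cat_uniq /= (sorted_pairwise le_trans) pairwise_cat /=.
case/and3P=> /allrelP t1_le _ /andP[/allP t2_ge _].
case/and3P=> _ /norP[vNt1 _] /andP[vNt2 _].
rewrite index_cat (negPf vNt1) /= eqxx addn0 count_cat /= lexx.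
rewrite (eq_in_count (a2 := predT)) => [|w wt1]; last first.
  by rewrite t1_le ?mem_head.
rewrite count_predT (eq_in_count (a2 := pred0)) => [|w wt2].
  by rewrite count_pred0 addn0 addn1.
apply/negP => wv; case/negP: vNt2.
by rewrite (@le_anti _ _ v w) // wv t2_ge.
Qed.

Lemma rank_pos p (U : {set 'I_p}) u : u \in U -> rank U u = pos U u.
Proof.
move=> uU; rewrite /rank (@pos_index _ _ U (enum U)) ?enum_uniq //.
  rewrite {1}/enum_mem -enumT; apply: (sorted_filter le_trans).
  have := iota_sorted 0 p; rewrite -val_enum_ord sorted_map.
  by apply: sub_sorted => i j; rewrite leEord.
by move=> w; rewrite mem_enum.
Qed.

Lemma pos_imset (d d' : Order.disp_t) (T : finPOrderType d)
    (T' : finPOrderType d') (f : T -> T') (U : {set T}) u :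
  {mono f : v w / (v <= w)%O} -> pos (f @: U) (f u) = pos U u.
Proof.
move=> f_mono; have f_inj := inc_inj f_mono.
rewrite /pos -(card_imset _ f_inj); apply: eq_card => w; rewrite inE.
apply/andP/imsetP => [[/imsetP[v vU ->]]|[v]].
  by rewrite f_mono => vu; exists v; rewrite ?inE ?vU.
by rewrite inE => /andP[vU vu] ->; rewrite f_mono imset_f.
Qed.

Lemma pos_ordT p (u : 'I_p) : pos setT u = u.+1.
Proof. by rewrite -rank_pos ?inE // /rank enum_setT -enumT index_enum_ord. Qed.

(** This turns iterated faces of x, defined by indices in sorted lists that
    shrink at every step, into images under a single order embedding. *)
Lemma vertex_enumeration (d : Order.disp_t) (V : finPOrderType d)
    (x : {set V}) p :
    chain_set x -> #|x| = p.+1 ->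
  exists f : 'I_p.+1 -> V,
    [/\ {mono f : u v / (u <= v)%O}, f @: setT = x
      & forall U : {set 'I_p.+1}, faces U x = x :\: f @: U].
Proof.
move=> x_tot card_x.
have /card_gt0P[v0 v0x] : (0 < #|x|)%N by rewrite card_x.
have size_t : size (vertices x) = p.+1 by rewrite size_vertices.
pose f (u : 'I_p.+1) := nth v0 (vertices x) u.
have fx u : f u \in x by rewrite -mem_vertices mem_nth ?size_t.
have index_f u : index (f u) (vertices x) = u.
  by rewrite index_uniq ?vertices_uniq ?size_t.
have f_index v : v \in x -> exists u, v = f u.
  rewrite -mem_vertices => vt.
  have lt_v : (index v (vertices x) < p.+1)%N by rewrite -size_t index_mem.
  by exists (Ordinal lt_v); rewrite /f nth_index.
have f_le : {homo f : u v / (u <= v)%O}.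
  move=> u v; rewrite leEord => uv.
  apply: (sorted_leq_nth le_trans (@le_refl _ _)); rewrite ?inE ?size_t //.
  exact: vertices_sorted.
exists f; split.
- apply: (le_mono (f := f)) => u v; rewrite !lt_def => /andP[vu uv].
  rewrite f_le // andbT; apply: contra vu => /eqP fvu.
  by apply/eqP/val_inj; rewrite /= -(index_f v) fvu index_f.
- apply/setP => v; apply/imsetP/idP => [[u _ ->]|/f_index[u ->]]; first exact: fx.
  by exists u.
move=> U.
have -> : faces U x = foldr (fun u y => face y u) x (map val (enum U)).
  by rewrite /faces; elim: (enum U) => //= u s ->.
rewrite foldr_face //; last first.
  rewrite {1}/enum_mem -enumT sorted_map; apply: sorted_filter.
    by move=> u v w; apply: ltn_trans.
  by have := iota_ltn_sorted 0 p.+1; rewrite -val_enum_ord sorted_map.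
apply/setP => v; rewrite !inE andbC; case: (boolP (v \in x)) => [/f_index[u ->]|];
  rewrite ?andbF ?andbT //.
rewrite index_f mem_map; last exact: val_inj.
rewrite mem_enum mem_imset // => u1 u2 f12.
by apply/val_inj; rewrite /= -(index_f u1) f12 index_f.
Qed.

(** For x = a_ij and S its part outside the intersection of a_i and a_j, this
    is ind. *)
Definition index_parity (d : Order.disp_t) (V : finPOrderType d)
  (x S : {set V}) (v : V) : 'F_2 := (pos x v + pos S v)%:R.

(** The position of an ordinal u among all ordinals is u + 1; because of this
    shift, the elements of the even part U^0 have parity 1. *)
Lemma mem_part01 p (U : {set 'I_p}) u :
  (u \in part0 U) = (u \in U) && (index_parity setT U u == 1) /\
  (u \in part1 U) = (u \in U) && (index_parity setT U u == 0).
Proof.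
rewrite !inE; case: (boolP (u \in U)) => //= uU; rewrite rank_pos //.
rewrite /index_parity pos_ordT F2_natr_odd F2_natr_eq1 F2_natr_eq0 !modn2 oddD /=.
by case: (odd u); case: (odd (pos U u)).
Qed.

(** * Pairs of faces given by a set of indices *)

Section Splitting.

Variables (d : Order.disp_t) (V : finPOrderType d).
Implicit Types (x y z : {set V}).

(** This says that (y, z) is the pair of faces (d_(U^0) x, d_(U^1) x) for some
    U, expressed without U: see [face_pair_split]. *)
Definition is_split x y z : bool :=
  let h := index_parity x ((y :\: z) :|: (z :\: y)) in
  [&& y :|: z == x, [forall v in z :\: y, h v == 1]
    & [forall v in y :\: z, h v == 0]].

Definition opposite_parities y z : bool :=
  let h := index_parity (y :|: z) ((y :\: z) :|: (z :\: y)) in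
  symdiff (h @: (y :\: z)) (h @: (z :\: y)) == [set 0; 1].

(** The two orders of y and z impose opposite values of the parity on
    nonempty sets, so at most one of them is a split. *)
Lemma is_split_sym x y z : ~~ (y \subset z) -> ~~ (z \subset y) ->
  ((y :|: z == x) && opposite_parities y z)%:R =
    (is_split x y z)%:R + (is_split x z y)%:R :> 'F_2.
Proof.
move=> yNz zNy; rewrite -F2_addb; congr (_%:R); congr nat_of_bool.
rewrite /is_split [z :|: y]setUC [(z :\: y) :|: _]setUC.
case: eqP => //= <-; rewrite /opposite_parities.
rewrite symdiff_imset_full ?setD_eq0 //; set h := index_parity _ _.
case: (boolP [forall v in z :\: y, h v == 1]) => //= /forall_inP h1.
case: (boolP [forall v in z :\: y, h v == 0]) => /= [/forall_inP h0|].
  have /subsetPn[v vz vNy] := zNy; have vzy : v \in z :\: y by rewrite inE vNy.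
  by have := h1 v vzy; rewrite (eqP (h0 v vzy)).
by rewrite andbF addbF orbF.
Qed.

Section Enumerated.

Variables (p : nat) (f : 'I_p.+1 -> V) (x : {set V}).
Hypothesis f_mono : {mono f : u v / (u <= v)%O}.
Hypothesis f_x : f @: setT = x.

Let f_inj : injective f := inc_inj f_mono.

Let fx u : f u \in x.
Proof. by rewrite -f_x imset_f. Qed.

Let fP v : v \in x -> exists u, v = f u.
Proof. by rewrite -f_x => /imsetP[u _ ->]; exists u. Qed.

Let parity_f (U : {set 'I_p.+1}) u :
  index_parity x (f @: U) (f u) = index_parity setT U u.
Proof. by rewrite /index_parity -f_x !pos_imset. Qed.

(** A set U giving the pair (y, z) is the set of indices of the symmetric
    difference of y and z; its even part comes from z minus y, its odd part
    from y minus z. *)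
Lemma face_pair_split (U : {set 'I_p.+1}) y z :
  (x :\: f @: part0 U == y) && (x :\: f @: part1 U == z) =
  (f @: U == (y :\: z) :|: (z :\: y)) && is_split x y z.
Proof.
set S := _ :|: _; apply/andP/andP => [[/eqP y_def /eqP z_def]|[/eqP fU]].
  have yP u : (f u \in y) = ~~ ((u \in U) && (index_parity setT U u == 1)).
    by rewrite -y_def inE fx andbT mem_imset // (mem_part01 U u).1.
  have zP u : (f u \in z) = ~~ ((u \in U) && (index_parity setT U u == 0)).
    by rewrite -z_def inE fx andbT mem_imset // (mem_part01 U u).2.
  have yx : y \subset x by rewrite -y_def subsetDl.
  have zx : z \subset x by rewrite -z_def subsetDl.
  have fU : f @: U = S.
    apply/setP => v; case: (boolP (v \in x)) => [/fP[u ->]|vNx].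
      rewrite mem_imset // !inE !yP !zP F2_neq1.
      by case: (u \in U); case: (_ == 1).
    rewrite [LHS](contraNF _ vNx) => [|/imsetP[u _ ->]]; last exact: fx.
    by rewrite !inE (contraNF (subsetP yx v) vNx) (contraNF (subsetP zx v) vNx).
  split; first exact/eqP.
  rewrite /is_split -/S -fU; apply/and3P; split.
  - rewrite eqEsubset subUset yx zx /=; apply/subsetP => v /fP[u ->].
    by rewrite inE yP zP F2_neq1; case: (u \in U); case: (_ == 1).
  - apply/forall_inP => v; rewrite inE => /andP[vNy vz].
    have [u def_v] := fP (subsetP zx v vz).
    by move: vNy; rewrite def_v yP parity_f negbK => /andP[].
  apply/forall_inP => v; rewrite inE => /andP[vNz vy].
  have [u def_v] := fP (subsetP yx v vy).
  by move: vNz; rewrite def_v zP parity_f negbK => /andP[].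
rewrite /is_split -/S -fU => /and3P[/eqP yz_x /forall_inP h1 /forall_inP h0].
have US u : (u \in U) = (f u \in S) by rewrite -fU mem_imset.
have yz u : (f u \in y) || (f u \in z) by rewrite -in_setU yz_x.
have yx : y \subset x by rewrite -yz_x subsetUl.
have zx : z \subset x by rewrite -yz_x subsetUr.
split; apply/eqP/setP => v; rewrite in_setD;
  (case: (boolP (v \in x)) => [/fP[u ->]|vNx]; last first;
    [by rewrite andbF ?(contraNF (subsetP yx v) vNx)
                ?(contraNF (subsetP zx v) vNx)|]);
  rewrite andbT mem_imset //;
  rewrite ?(mem_part01 U u).1 ?(mem_part01 U u).2 -parity_f US !inE;
  have := h1 (f u); have := h0 (f u); rewrite !inE; have := yz u;
  case: (f u \in y); case: (f u \in z) => //= _.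
- by move=> /(_ isT) /eqP->.
- by move=> _ /(_ isT) /eqP->.
- by move=> /(_ isT) /eqP->.
- by move=> _ /(_ isT) /eqP->.
Qed.

(** Only the preimage of the symmetric difference can contribute, and if (y, z)
    is a split that set has the required q + q elements. *)
Lemma sum_is_split y z q :
    (#|x| = #|y| + q)%N -> (#|x| = #|z| + q)%N ->
  \sum_(U : {set 'I_p.+1} | #|U| == (q + q)%N)
    ((x :\: f @: part0 U == y) && (x :\: f @: part1 U == z))%:R
  = (is_split x y z)%:R :> 'F_2.
Proof.
move=> card_y card_z; under eq_bigr do rewrite face_pair_split.
case: (boolP (is_split x y z)) => [/and3P[/eqP yz_x _ _]|_]; last first.
  by rewrite big1 // => U _; rewrite andbF.
set S := _ :|: _.
have z_out : y :\: z = x :\: z by rewrite -yz_x setDUl setDv setU0.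
have y_out : z :\: y = x :\: y by rewrite -yz_x setDUl setDv set0U.
have card_S : #|S| = (q + q)%N.
  have yx : y \subset x by rewrite -yz_x subsetUl.
  have zx : z \subset x by rewrite -yz_x subsetUr.
  rewrite cardsU (_ : _ :&: _ = set0) ?cards0 ?subn0; last first.
    by apply/setP => v; rewrite !inE; case: (v \in y); case: (v \in z).
  rewrite z_out y_out !cardsD (setIidPr yx) (setIidPr zx) {1}card_z card_y.
  by rewrite !addKn.
have fS : f @: (f @^-1: S) = S.
  apply/setP => v; apply/imsetP/idP => [[u]|vS]; first by rewrite inE => uS ->.
  have /imsetP[u _ def_v] : v \in f @: setT.
    rewrite f_x -yz_x; move: vS; rewrite !inE.
    by case/orP=> /andP[_ ->]; rewrite ?orbT.
  by exists u; rewrite // inE -def_v.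
rewrite (bigD1 (f @^-1: S)) /=; last by rewrite -(card_imset _ f_inj) fS card_S.
rewrite fS eqxx big1 ?addr0 // => U /andP[_ neqU]; case: eqP => // fU.
case/eqP: neqU; apply: (imset_inj f_inj).
by rewrite fS fU.
Qed.

End Enumerated.

End Splitting.

(** * Evaluation of the cup product and of the algorithm *)

Section Cup.

Variables (d : Order.disp_t) (V : finPOrderType d) (X : complex V).
Implicit Types (x y z : {set V}).

Lemma cochain_gen (alpha : cochain X) y :
  y \in simplices X -> alpha (gen X y) = (y \in supp alpha)%:R.
Proof. by move=> yX; rewrite inE yX -F2_bool. Qed.

Lemma nsimplices_card n x : x \in nsimplices X n -> x \in simplices X /\ #|x| = n.+1.
Proof. by rewrite inE => /andP[xX /eqP]. Qed.

Lemma simplex_chain_set x : x \in simplices X -> chain_set x.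
Proof. by move=> xX; apply: complex_total xX. Qed.

Lemma cup_gen (alpha : cochain X) (q p : nat) x :
    x \in simplices X -> #|x| = p.+1 -> (q <= p)%N ->
  cup q%:Z alpha alpha (gen X x) =
    \sum_(U : {set 'I_p.+1} | #|U| == (p - q)%N)
      (faces (part0 U) x \in supp alpha)%:R *
      (faces (part1 U) x \in supp alpha)%:R.
Proof.
move=> xX card_x q_le.
have s_proof : (x \in X) && (x != set0) by rewrite xX -card_gt0 card_x.
have -> : gen X x = Defs.basis (Sub x s_proof : simplex X) by rewrite /gen insubT.
rewrite /cup /= linext_basis /coproduct_basis /=.
have dim_x : Defs.dim x = p by rewrite /Defs.dim card_x.
have faces_x (U : {set 'I_p.+1}) : faces U x \in simplices X.
  have [f [_ _ ->]] := vertex_enumeration (simplex_chain_set xX) card_x.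
  exact: complex_sub xX (subsetDl _ _).
rewrite dim_x ifT; last by lia.
rewrite linear_sum /=; apply: eq_big => [U|U _]; first by lia.
by rewrite tens_formE !cochain_gen.
Qed.

Lemma in_imset_sum (T : finType) m (a : 'I_m -> T) (y : T) : injective a ->
  (y \in [set a i | i : 'I_m])%:R = \sum_i (y == a i)%:R :> 'F_2.
Proof.
move=> a_inj; case: imsetP => [[i _ ->]|yNa].
  rewrite (bigD1 i) //= eqxx big1 ?addr0 // => j /negPf.
  by rewrite (inj_eq a_inj) eq_sym => ->.
by rewrite big1 // => i _; case: eqP => // yi; case: yNa; exists i.
Qed.

(** Replacing B by its symmetric difference with a singleton adds 1 to the
    indicator function of B at that point. *)
Lemma in_steenrod_alg n k m (a : 'I_m -> {set V}) x : x \in nsimplices X (n + k) ->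
  (x \in steenrod_alg X n k a)%:R =
  \sum_(p : 'I_m * 'I_m | (p.1 < p.2)%N)
    ((a p.1 :|: a p.2 == x) && opposite_parities (a p.1) (a p.2))%:R :> 'F_2.
Proof.
move=> xX; pose hit (p : 'I_m * 'I_m) :=
  (a p.1 :|: a p.2 == x) && opposite_parities (a p.1) (a p.2).
have stepE B y z :
    x \in steenrod_step X n k B y z =
      (x \in B) (+) ((y :|: z == x) && opposite_parities y z).
  rewrite /steenrod_step /= -/(index_parity _ _) -/(opposite_parities y z).
  case: (altP eqP) => [->|yzx].
    by rewrite xX; case: ifP => _; rewrite ?addbF // !inE eqxx; case: (x \in B).
  rewrite addbF; case: ifP => // _; case: ifP => // _.
  by rewrite !inE eq_sym (negPf yzx) orbF andbF.
have foldE (s : seq ('I_m * 'I_m)) B :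
    (x \in foldl (fun B p => steenrod_step X n k B (a p.1) (a p.2)) B s)%:R =
    (x \in B)%:R + \sum_(p <- s) (hit p)%:R :> 'F_2.
  elim: s B => [|p s IHs] B /=; first by rewrite big_nil addr0.
  by rewrite IHs stepE F2_addb big_cons addrA.
rewrite foldE inE add0r big_filter; apply: perm_big; apply: uniq_perm.
- by apply: allpairs_uniq; rewrite ?enum_uniq // => -[? ?] [? ?] _ _ /= [-> ->].
- exact: index_enum_uniq.
move=> [i j]; rewrite mem_index_enum; apply/allpairsP.
by exists (i, j); rewrite !mem_enum.
Qed.

Lemma steenrod_alg_sub n k m (a : 'I_m -> {set V}) :
  steenrod_alg X n k a \subset nsimplices X (n + k).
Proof.
rewrite /steenrod_alg; set s := [seq _ <- _ | _].
move: (sub0set (nsimplices X (n + k))).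
elim: s set0 => //= p s IHs B BX; apply: IHs; rewrite /steenrod_step.
case: ifP => // pX; case: ifP => // _.
by apply: subset_trans (subsetDl _ _) _; rewrite subUset BX sub1set.
Qed.

Lemma sum_pairs (W : nmodType) m (F : 'I_m -> 'I_m -> W) : (forall i, F i i = 0) ->
  \sum_i \sum_j F i j =
  \sum_(p : 'I_m * 'I_m | (p.1 < p.2)%N) (F p.1 p.2 + F p.2 p.1).
Proof.
move=> F_diag; rewrite pair_big /= (bigID (fun p : 'I_m * 'I_m => (p.1 < p.2)%N)) /=.
rewrite big_split /=; congr (_ + _).
rewrite (bigID (fun p : 'I_m * 'I_m => p.2 == p.1)) /= big1 ?add0r; last first.
  by move=> p /andP[_ /eqP->].
rewrite (reindex_inj (h := fun p : 'I_m * 'I_m => (p.2, p.1))); last first.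
  by move=> [? ?] [? ?] /= [-> ->].
by apply: eq_bigl => p /=; rewrite -leqNgt ltn_neqAle andbC.
Qed.

(** A nonzero term for U gives faces with n + 1 vertices, so both parts of U
    have p - n elements if x has dimension p; as U has p - (n - k) elements,
    p = n + k. *)
Lemma supp_cup_nsimplices (alpha : cochain X) n k x : (k <= n)%N ->
    supp alpha \subset nsimplices X n ->
    x \in supp (cup (n%:Z - k%:Z) alpha alpha) ->
  x \in nsimplices X (n + k).
Proof.
move=> kn alphaX; rewrite subzn // !inE => /andP[xX].
case: (posnP #|x|) => [/eqP|card_x_gt0].
  rewrite cards_eq0 => /eqP ->; rewrite /gen insubF ?eqxx ?andbF //.
  by rewrite linear0 eqxx.
have [p card_x] : exists p, #|x| = p.+1 by exists #|x|.-1; rewrite prednK.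
case: (leqP (n - k) p) => [nk_le|nk_gt]; last first.
  rewrite /gen; case: insubP => [s _ sx|_]; last by rewrite linear0 eqxx.
  rewrite /cup /= linext_basis /coproduct_basis /= sx /Defs.dim card_x.
  by rewrite ifF ?linear0 ?eqxx //; lia.
rewrite (cup_gen _ xX card_x nk_le) => sum_neq0; rewrite xX /=.
have [f [f_mono f_x facesE]] := vertex_enumeration (simplex_chain_set xX) card_x.
have f_inj := inc_inj f_mono.
have [U /andP[/eqP card_U /andP[U0 U1]]] : exists U : {set 'I_p.+1},
    (#|U| == p - (n - k))%N && ((faces (part0 U) x \in supp alpha)
      && (faces (part1 U) x \in supp alpha)).
  apply/existsP; apply: contraNT sum_neq0 => /existsPn no_U.
  rewrite big1 // => U card_U; have := no_U U; rewrite card_U /=.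
  by case: (_ \in _); case: (_ \in _); rewrite // ?mulr0 ?mul0r.
have card_face (W : {set 'I_p.+1}) :
    faces W x \in supp alpha -> (#|x| = n.+1 + #|W|)%N.
  move=> /(subsetP alphaX)/nsimplices_card[_]; rewrite facesE cardsD.
  have fWx : f @: W \subset x by rewrite -f_x imsetS ?subsetT.
  have := subset_leq_card fWx.
  by rewrite (setIidPr fWx) card_imset // => le_W eq_n; rewrite -eq_n subnK.
have card01 : (#|part0 U| + #|part1 U| = #|U|)%N.
  rewrite -(cardsID [set u : 'I_p.+1 | u == rank U u %[mod 2]] U).
  by congr (_ + _)%N; apply: eq_card => u; rewrite !inE // andbC.
move: card01 (card_face _ U0) (card_face _ U1); rewrite card_U card_x.
by move: #|part0 U| #|part1 U| => u0 u1; lia.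
Qed.

End Cup.

Theorem theorem14 (d : Order.disp_t) (V : finPOrderType d) (X : complex V)
  (n k : nat) (n_ge1 : (1 <= n)%N) (k_range : (1 <= k <= n)%N)
  (m : nat) (a : 'I_m -> {set V}) (a_inj : injective a)
  (a_simplex : forall i : 'I_m, a i \in nsimplices X n)
  (alpha : cochain X) (alpha_cocycle : cocycle alpha)
  (alpha_supp : supp alpha = [set a i | i : 'I_m]) :
  let beta := cup (n%:Z - k%:Z) alpha alpha in
  let B := steenrod_alg X n k a in
  supp beta = B /\
  (forall x : {set V}, x \in nsimplices X (n + k) ->
     (x \in B -> beta (gen X x) = 1) /\ (x \notin B -> beta (gen X x) = 0)).
Proof.
move=> beta B; have [k_gt0 kn] := andP k_range.
have card_a i : #|a i| = n.+1 := (nsimplices_card (a_simplex i)).2.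
have betaE x : x \in nsimplices X (n + k) -> beta (gen X x) = (x \in B)%:R.
  move=> xXnk; have [xX card_x] := nsimplices_card xXnk.
  have [f [f_mono f_x facesE]] := vertex_enumeration (simplex_chain_set xX) card_x.
  have aNsub i j : i != j -> ~~ (a i \subset a j).
    apply: contra => a_sub; apply/eqP/a_inj/eqP.
    by rewrite eqEcard a_sub !card_a /=.
  rewrite /beta subzn // (cup_gen _ xX card_x); last by lia.
  rewrite in_steenrod_alg //.
  transitivity (\sum_i \sum_j (is_split x (a i) (a j))%:R : 'F_2).
    under eq_bigr => U _ do rewrite !facesE alpha_supp !in_imset_sum // big_distrlr /=.
    rewrite exchange_big /=; apply: eq_bigr => i _.
    rewrite exchange_big /=; apply: eq_bigr => j _.
    rewrite -(@sum_is_split _ _ _ f x _ _ _ _ k) //; try by rewrite card_x card_a; lia.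
    (* the sets U have (n + k) - (n - k) = k + k elements *)
    apply: eq_big => [U|U _]; first by congr (_ == _); lia.
    by rewrite -natrM mulnb.
  rewrite sum_pairs => [|i]; last first.
    (* a_i alone cannot cover x, as k > 0 *)
    rewrite /is_split setUid; case: eqP => //= ax.
    by move: card_x; rewrite -ax card_a; lia.
  apply: eq_bigr => -[i j] /= ij; rewrite is_split_sym // aNsub //.
    by rewrite neq_ltn ij.
  by rewrite neq_ltn ij orbT.
split; last first.
  by move=> x xXnk; rewrite betaE //; split => [-> //|/negPf ->].
have alphaX : supp alpha \subset nsimplices X n.
  by rewrite alpha_supp; apply/subsetP => _ /imsetP[i _ ->].
apply/setP => x; case: (boolP (x \in nsimplices X (n + k))) => [xXnk|xNX].
  by rewrite inE (nsimplices_card xXnk).1 betaE // F2_natr_eq0 negbK.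
rewrite (contraNF (subsetP (steenrod_alg_sub _ _ _ _) x) xNX).
exact: contraNF (supp_cup_nsimplices kn alphaX) xNX.
Qed.
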